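(* Let $\mathcal{A}$ be a finite alphabet. For integers $j\ge 0$ and $m\ge 1$ let $\psi_{j,m}:\mathcal{A}^{\mathbb{N}}\to\mathcal{A}^{\mathbb{N}}$ be the decimation map $\psi_{j,m}(a_0a_1a_2\cdots)=a_ja_{j+m}a_{j+2m}\cdots$. (1) For any path set $\mathcal{P}\subseteq\mathcal{A}^{\mathbb{N}}$ and any $(j,m)$ with $j\ge 0$ and $m\ge 1$, the decimated set $\mathcal{P}_{j,m}:=\psi_{j,m}(\mathcal{P})=\{\psi_{j,m}(x):x\in\mathcal{P}\}$ is a path set. (2) Suppose that the path set $\mathcal{P}$ is shift-invariant. Then every decimated set $\mathcal{P}_{j,m}$ is shift-invariant. In addition, for fixed $m$ all the sets $\mathcal{P}_{j,m}$ for $j\ge 0$ are equal. (The abbreviated notation $\mathcal{P}_m$ may be used in this case.)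
   Context: $\mathcal{A}^{\mathbb{N}}$ is the set of one-sided infinite sequences $a_0a_1a_2\cdots$ with $a_i\in\mathcal{A}$, and $\sigma(a_0a_1a_2\cdots)=a_1a_2a_3\cdots$ is the one-sided shift. A set $X\subseteq\mathcal{A}^{\mathbb{N}}$ is shift-invariant if $\sigma(X)\subseteq X$. A labeled directed graph over $\mathcal{A}$ is a finite directed graph $\mathcal{G}$ whose edges carry labels from $\mathcal{A}$; loops and multiple edges are allowed, but the triples (initial vertex, terminal vertex, label) are required to be distinct. A pointed graph $(\mathcal{G},v)$ is such a graph with a distinguished vertex $v$. The path set $X_{\mathcal{G}}(v)\subseteq\mathcal{A}^{\mathbb{N}}$ is the set of all sequences of successive edge labels of one-sided infinite walks in $\mathcal{G}$ starting at $v$. A subset of $\mathcal{A}^{\mathbb{N}}$ is a path set if it equals $X_{\mathcal{G}}(v)$ for some pointed graph $(\mathcal{G},v)$ over $\mathcal{A}$.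
   Formalization: The last claim of (2), that all P_{j,m} are equal for fixed m, is proved under the added assumption that P is contained in σ(P), so σ(P)=P; with only σ(P)⊆P it fails for P={abbb..., bbb...}, m=1, j=0,1. *)

(* Defs.v *)
From mathcomp Require Import all_boot.
From mathcomp Require Import boolp classical_sets.

Set Implicit Arguments.
Unset Strict Implicit.
Unset Printing Implicit Defensive.

Local Open Scope classical_set_scope.

(* An edge is the triple (initial vertex, terminal vertex, label): loops and
   multiple edges are allowed, and since the edges form a set, these triples are
   distinct. Vertices without outgoing edges are allowed. *)
Record labeled_digraph (A : finType) : Type := LabeledDigraph {
  vertex : finType;
  edges : {set vertex * vertex * A}
}.

Definition infinite_walk (A : finType) (G : labeled_digraph A)
    (w : nat -> vertex G) (x : nat -> A) : Prop :=
  forall n : nat, (w n, w n.+1, x n) \in edges G.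

Definition path_set_of (A : finType) (G : labeled_digraph A) (v : vertex G)
    : set (nat -> A) :=
  [set x | exists w : nat -> vertex G, w 0 = v /\ infinite_walk w x].

Definition is_path_set (A : finType) (P : set (nat -> A)) : Prop :=
  exists (G : labeled_digraph A) (v : vertex G), P = path_set_of v.

Definition shift (A : Type) (x : nat -> A) : nat -> A := fun n => x n.+1.

Definition shift_invariant (A : Type) (X : set (nat -> A)) : Prop :=
  [set shift x | x in X] `<=` X.

Definition decimation (A : Type) (j m : nat) (x : nat -> A) : nat -> A :=
  fun n => x (j + n * m).

Definition decimated_set (A : Type) (j m : nat) (P : set (nat -> A))
    : set (nat -> A) :=
  [set decimation j m x | x in P].

(* Main.v *)
(** Grouping an infinite walk into an initial block of [j] edges followed by
    blocks of [m] edges, only the first label of each block of length [m]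
    survives the decimation. So [P_{j,m}] is presented by the graph whose edges
    are the walks of length [m], labelled by their first edge; a fresh initial
    vertex stands for all the vertices that a walk of length [j] from [v] can
    reach. For (2), one uses [shift (decimation j m x) = decimation j m (shift^m x)]
    and [decimation j m x = decimation 0 m (shift^j x)]. *)
Require Import Defs.
From mathcomp Require Import all_boot.
From mathcomp Require Import boolp classical_sets.

Local Open Scope classical_set_scope.

Section Decimation.
Context {A : finType}.
Implicit Types (P : set (nat -> A)) (x : nat -> A).

Section FiniteWalks.
Context (G : labeled_digraph A).

(** Walks of length [n] are kept as total functions with arbitrary values past the end, so a segment
    of an infinite walk is again such a pair. *)
Definition finite_walk (n : nat) (w : nat -> vertex G) (x : nat -> A) :=
  forall i, i < n -> (w i, w i.+1, x i) \in edges G.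

Lemma infinite_walk_cat n w0 x0 w x :
  finite_walk n w0 x0 -> infinite_walk w x -> w0 n = w 0 ->
  infinite_walk (fun i => if i < n then w0 i else w (i - n))
                (fun i => if i < n then x0 i else x (i - n)).
Proof.
move=> walk0 walk w0n i; case: (ltnP i n) => [lt_in | le_ni].
  (* The seam: the last edge of the finite walk ends at [w0 n], which is [w 0]. *)
  case: ltnP => [_ | le_n_i1]; first exact: walk0.
  have def_n : n = i.+1 by apply/eqP; rewrite eqn_leq le_n_i1.
  by move: (walk0 i lt_in); rewrite def_n subnn -w0n def_n.
by rewrite ltnNge leqW //= subSn //; apply: walk.
Qed.

Lemma infinite_walk_flatten m (w : nat -> nat -> vertex G) (x : nat -> nat -> A) :
  0 < m -> (forall n, finite_walk m (w n) (x n)) ->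
  (forall n, w n m = w n.+1 0) ->
  infinite_walk (fun i => w (i %/ m) (i %% m)) (fun i => x (i %/ m) (i %% m)).
Proof.
move=> m_gt0 walk glue i; have lt_im : i %% m < m by rewrite ltn_mod.
(* Only the end of a block needs care: there [i.+1] is position 0 of the next block, and [glue]
   identifies the two vertices. *)
suff -> : w (i.+1 %/ m) (i.+1 %% m) = w (i %/ m) (i %% m).+1 by apply: walk.
have -> : i.+1 = i %/ m * m + (i %% m).+1 by rewrite addnS -divn_eq.
rewrite divnMDl // modnMDl.
case: (ltnP (i %% m).+1 m) => [lt_i1m | le_m_i1].
  by rewrite (divn_small lt_i1m) (modn_small lt_i1m) addn0.
have -> : (i %% m).+1 = m by apply/eqP; rewrite eqn_leq lt_im.
by rewrite divnn m_gt0 modnn addn1 glue.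
Qed.

Context (v : vertex G) (j m : nat).

Definition reaches_in (u : vertex G) :=
  exists w x, [/\ w 0 = v, w j = u & finite_walk j w x].

Definition block (u u' : vertex G) (a : A) :=
  exists w x, [/\ w 0 = u, w m = u', x 0 = a & finite_walk m w x].

(** [p] records the true endpoints in [G], since the source [None] leaves the first one open. No
    edge returns to [None]. *)
Definition decimated_edge (s t : option (vertex G)) (a : A) (p : vertex G * vertex G) :=
  [/\ if s is Some u then u = p.1 else reaches_in p.1,
      t = Some p.2 & block p.1 p.2 a].

Definition decimated_graph : labeled_digraph A :=
  @LabeledDigraph A (option (vertex G))
    [set e | `[< exists p, decimated_edge e.1.1 e.1.2 e.2 p >]]%SET.

Lemma decimated_path_set : 0 < m ->
  decimated_set j m (path_set_of v) = @path_set_of A decimated_graph None.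
Proof.
move=> m_gt0; apply/seteqP; split => [_ [x [w [w0 walk]] <-] | y [W [W0 Wwalk]]].
  (* The vertices of [w] at the sampled times, with [None] in place of [w j]. *)
  exists (fun n => if n is n'.+1 then Some (w (j + n * m)) else None).
  split=> // n; rewrite inE; apply/asboolP.
  exists (w (j + n * m), w (j + n.+1 * m)); split=> //=.
    by case: n => //; rewrite mul0n addn0; exists w, x; split=> // i _; apply: walk.
  exists (fun i => w (j + n * m + i)), (fun i => x (j + n * m + i)).
  split=> [||| i _] /=; rewrite ?addn0 ?addnS //.
  by rewrite mulSn -addnA [m + _]addnC.
have /choice[p pP] n : exists p, decimated_edge (W n) (W n.+1) (y n) p.
  by have := Wwalk n; rewrite inE => /asboolP.
(* From time 1 on the vertices of [W] have the form [Some u], so consecutive choices of endpoints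
   agree. *)
have p_next n : (p n).2 = (p n.+1).1.
  by have [_ eqW _] := pP n; have [+ _ _] := pP n.+1; rewrite eqW.
have [w0 [x0 [w00 w0j walk0]]] : reaches_in (p 0).1.
  by have [+ _ _] := pP 0; rewrite W0.
have /choice[q qP] n : exists q : (nat -> vertex G) * (nat -> A),
    [/\ q.1 0 = (p n).1, q.1 m = (p n).2, q.2 0 = y n & finite_walk m q.1 q.2].
  by have [_ _ [w [x wx]]] := pP n; exists (w, x).
have walk : infinite_walk (fun i => (q (i %/ m)).1 (i %% m))
                          (fun i => (q (i %/ m)).2 (i %% m)).
  apply: (infinite_walk_flatten m (fun n => (q n).1) (fun n => (q n).2)) => // n.
    by have [] := qP n.
  by have [_ -> _ _] := qP n; have [-> _ _ _] := qP n.+1.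
have q00 : w0 j = (q (0 %/ m)).1 (0 %% m).
  by rewrite div0n mod0n w0j; have [-> _ _ _] := qP 0.
have walk' := infinite_walk_cat _ _ _ _ _ walk0 walk q00.
eexists; first (eexists; split; last exact: walk').
  (* For [j = 0] the initial walk is empty and the start is that of the first block, equal to [v] by
     [q00]. *)
  have [j0 /= | //] := posnP j.
  by rewrite sub0n -q00 j0.
(* Index [j + n * m] is position 0 of block [n], whose label there is [y n]. *)
apply/funext => n; rewrite /decimation ltnNge leq_addr /= addKn.
by rewrite mulnK // modnMl; have [_ _ -> _] := qP n.
Qed.

End FiniteWalks.

Lemma is_path_set_decimated P j m :
  is_path_set P -> 0 < m -> is_path_set (decimated_set j m P).
Proof.
by move=> [G [v ->]] m_gt0; exists (decimated_graph G v j m), None;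
  apply: decimated_path_set.
Qed.

Lemma iter_shiftE k x n : iter k (@shift A) x n = x (k + n).
Proof. by elim: k n => //= k IHk n; rewrite /shift IHk addnS. Qed.

Lemma shift_invariant_iter P k x :
  shift_invariant P -> P x -> P (iter k (@shift A) x).
Proof. by move=> invP Px; elim: k => //= k IHk; apply: invP; exists (iter k (@shift A) x). Qed.

Lemma shift_surjective_iter P k x :
  P `<=` [set shift x | x in P] -> P x -> exists2 y, P y & iter k (@shift A) y = x.
Proof.
move=> surjP; elim: k x => [|k IHk] x Px; first by exists x.
have [y Py <-] := surjP x Px; have [z Pz <-] := IHk y Py.
by exists z.
Qed.

Lemma decimation_iter_shift j m x :
  decimation 0 m (iter j (@shift A) x) = decimation j m x.
Proof. by apply/funext => n; rewrite /decimation iter_shiftE. Qed.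

Lemma shift_decimation j m x :
  shift (decimation j m x) = decimation j m (iter m (@shift A) x).
Proof.
by apply/funext => n; rewrite /shift /decimation iter_shiftE mulSn addnCA.
Qed.

Lemma shift_invariant_decimated P j m :
  shift_invariant P -> shift_invariant (decimated_set j m P).
Proof.
move=> invP _ [_ [x Px <-] <-]; rewrite shift_decimation.
by exists (iter m (@shift A) x) => //; apply: shift_invariant_iter.
Qed.

(** Invariance keeps the [j]-fold shift of [x] in [P], giving one inclusion; a [j]-fold preimage of
    [x] in [P] gives the other. *)
Lemma decimated_set_offset P j m :
  shift_invariant P -> P `<=` [set shift x | x in P] ->
  decimated_set j m P = decimated_set 0 m P.
Proof.
move=> invP surjP; apply/seteqP; split=> _ [x Px <-].
  rewrite -decimation_iter_shift; exists (iter j (@shift A) x) => //.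
  exact: shift_invariant_iter.
have [y Py <-] := shift_surjective_iter P j x surjP Px.
by exists y => //; rewrite decimation_iter_shift.
Qed.

End Decimation.

(* The equality of the decimated sets needs shift P = P: with only the inclusion
   of shift P in P it fails for P = {abbb..., bbb...}, m = 1, j = 0, k = 1. *)
Theorem theorem1p5 (A : finType) :
  (forall P : set (nat -> A), is_path_set P ->
     forall j m : nat, 0 < m -> is_path_set (decimated_set j m P))
  /\
  (forall P : set (nat -> A), is_path_set P -> shift_invariant P ->
     (forall j m : nat, 0 < m -> shift_invariant (decimated_set j m P))
     /\
     (P `<=` [set shift x | x in P] ->
        forall m : nat, 0 < m ->
          forall j k : nat, decimated_set j m P = decimated_set k m P)).
Proof.
split=> [P pathP j m m_gt0 | P _ invP]; first exact: is_path_set_decimated.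
split=> [j m _ | surjP m _ j k]; first exact: shift_invariant_decimated.
by rewrite (decimated_set_offset P j) // (decimated_set_offset P k).
Qed.
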